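(* Let $p$ be a Markov transition kernel on a countable set $V$ (with not necessarily rational entries) such that for each $u$ there are only finitely many $v$ with $p(u,v)>0$. Let $a,b,c$ be distinct vertices with $p(b,a)=p(c,a)=1$. Let a stack mechanism on $V$ be chosen so that, for each vertex $u$, every successor $u^{(j)}$ satisfies $p(u,u^{(j)})>0$ and $$\Big|p(u,v)\,t-\#\{s\le t: u^{(s)}=v\}\Big|\le 1\quad\text{for all } v \text{ with } p(u,v)>0 \text{ and all } t\ge1$$ (in particular $b^{(i)}=c^{(i)}=a$ for all $i$). Let $h(v):=\mathbb{P}_v(T_b<T_c)$, and suppose that $$K_6:=1+\sum_{u\in V\setminus\{b,c\},\ v\in V:\ p(u,v)>0}|h(u)-h(v)|$$ is finite. Then for the stack walk $x_0,x_1,\ldots$ (from any initial vertex $x_0$) and any $t$ with $n_t(b)+n_t(c)>0$, $$\left| h(a)-\frac{n_t(b)}{n_t(b)+n_t(c)}\right| \leq\frac{K_6}{n_t(b)+n_t(c)}.$$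
   Context: $\mathbb{P}_u$ is the law of the Markov chain $(X_t)_{t\ge0}$ with transition kernel $p$ started at $X_0=u$; $T_v:=\min\{t\ge 0: X_t=v\}$, with $\min\emptyset:=\infty$. A stack mechanism is an assignment of an infinite sequence of successors $u^{(1)},u^{(2)},\ldots\in V$ to each vertex $u\in V$. The stack walk started at $x_0$ is the sequence of vertices defined inductively by $x_{t+1}:=x_t^{(n_t(x_t)+1)}$, where $n_t(v):=\#\{s\in\{0,\ldots,t-1\}:x_s=v\}$. Stack mechanisms as in the claim exist: for all $p_1,\ldots,p_n\in(0,1]$ with sum $1$ there is a sequence $z_1,z_2,\ldots\in\{1,\ldots,n\}$ with $|p_it-\#\{s\le t:z_s=i\}|\le1$ for all $i,t$; apply this with $p_i=p(u,v_i)$, where $v_1,\ldots,v_n$ enumerates the vertices $v$ with $p(u,v)>0$, and set $u^{(j)}=v_{z_j}$. *)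

(* Defs.v *)
From HB Require Import structures.
From mathcomp Require Import all_boot all_order all_algebra.
From mathcomp Require Import all_classical all_reals all_analysis.

Set Implicit Arguments.
Unset Strict Implicit.
Unset Printing Implicit Defensive.
Import Order.TTheory GRing.Theory Num.Theory.
Import numFieldNormedType.Exports.
Local Open Scope classical_set_scope.
Local Open Scope ring_scope.

Definition markov_kernel (R : realType) (V : countType) (p : V -> V -> R)
    : Prop :=
  (forall u v, 0 <= p u v) /\
  (forall u, \esum_(v in [set: V]) (p u v)%:E = 1%E).

(* V carries its discrete sigma-algebra; as V is countable, measurability of
   X_t amounts to measurability of the fibres.  The last clause is the Markov
   property
     P(X_{n+1} = x_{n+1} | X_0 = x_0, ..., X_n = x_n) = p(x_n, x_{n+1})
   multiplied out, so that conditioning on null events does not arise. *)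
Definition markov_chain (R : realType) (V : countType) (p : V -> V -> R)
    (u : V) (d : measure_display) (Omega : measurableType d)
    (P : probability Omega R) (X : nat -> Omega -> V) : Prop :=
  [/\ forall t v, measurable (X t @^-1` [set v]),
      P (X 0%N @^-1` [set u]) = 1%E &
      forall (x : nat -> V) (n : nat),
        P [set w | forall i, (i <= n.+1)%N -> X i w = x i] =
        (P [set w | forall i, (i <= n)%N -> X i w = x i] *
           (p (x n) (x n.+1))%:E)%E].

(* The infimum of the empty set is +oo; that of a nonempty set of naturals is
   its minimum. *)
Definition hitting_time (R : realType) (V : countType) (y : nat -> V) (v : V)
    : \bar R :=
  ereal_inf [set (t%:R)%:E | t in [set t : nat | y t = v]].

Definition hit_before_prob (R : realType) (V : countType)
    (d : measure_display) (Omega : measurableType d)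
    (P : probability Omega R) (X : nat -> Omega -> V) (b c : V) : R :=
  fine (P [set w | (hitting_time R (X ^~ w) b < hitting_time R (X ^~ w) c)%E]).

(* [sigma u j] is the successor u^(j), for j >= 1; the value [sigma u 0] is
   never used. *)
Definition low_discrepancy_stack (R : realType) (V : countType)
    (p : V -> V -> R) (sigma : V -> nat -> V) : Prop :=
  (forall u j, (1 <= j)%N -> 0 < p u (sigma u j)) /\
  (forall u v, 0 < p u v -> forall t, (1 <= t)%N ->
     `|p u v * t%:R -
       (count (fun s => sigma u s == v) (index_iota 1 t.+1))%:R| <= 1).

Definition visits (V : countType) (x : nat -> V) (t : nat) (v : V) : nat :=
  count (fun s => x s == v) (index_iota 0 t).

Definition stack_walk (V : countType) (sigma : V -> nat -> V) (x : nat -> V)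
    : Prop :=
  forall t, x t.+1 = sigma (x t) (visits x t (x t)).+1.

Definition K6 (R : realType) (V : countType) (p : V -> V -> R) (h : V -> R)
    (b c : V) : \bar R :=
  (1 + \esum_(e in [set e : V * V | [/\ e.1 <> b, e.1 <> c &
                                        (0 < p e.1 e.2)%R]])
         `|h e.1 - h e.2|%:E)%E.

(* Main.v *)
(* Telescoping h(x_t) - h(x_0) along the stack walk and grouping the steps by
   the vertex they leave: the exits from b contribute n_t(b) (h(a) - 1), those
   from c contribute n_t(c) h(a), and those from any other vertex u contribute
   at most the sum of |h(u) - h(v)| over the successors v, since h is harmonic
   at u and the stack follows p(u, .) up to an error 1.  Hence
   |(n_t(b) + n_t(c)) h(a) - n_t(b)| <= (K6 - 1) + |h(x_t) - h(x_0)| <= K6.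
   For the harmonicity of h, the event T_b < T_c is split according to the first
   time n at which {b, c} is visited; the probabilities of the pieces satisfy
   the one-step recursion in n. *)
Require Import Defs.
From HB Require Import structures.
From mathcomp Require Import all_boot all_order all_algebra.
From mathcomp Require Import all_classical all_reals all_analysis.
From mathcomp Require Import ring lra.
Set Implicit Arguments.
Unset Strict Implicit.
Import Order.TTheory GRing.Theory Num.Theory.
Import numFieldNormedType.Exports.
Local Open Scope classical_set_scope.
Local Open Scope ring_scope.

(** * Regrouping finite sums by value, and exits counted along the walk *)

Lemma sum_count (R : pzRingType) (I T : eqType) (r : seq I) (S : seq T)
    (f : I -> T) (g : T -> R) :
  uniq S -> {in r, forall i, f i \in S} ->
  \sum_(i <- r) g (f i) = \sum_(v <- S) (count (fun i => f i == v) r)%:R * g v.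
Proof.
move=> uS; elim: r => [|i r IH] fS.
  by rewrite big_nil big1// => v _; rewrite mul0r.
rewrite big_cons IH => [|j jr]; last by apply: fS; rewrite inE jr orbT.
have fi : f i \in S by apply: fS; rewrite inE eqxx.
under [RHS]eq_bigr => v _ do rewrite /= natrD mulrDl.
rewrite big_split/=; congr (_ + _).
rewrite (bigD1_seq (f i))//= eqxx mul1r big1 ?addr0// => v.
by rewrite eq_sym => /negbTE ->; rewrite mul0r.
Qed.

Lemma sum_by_value (V : nmodType) (I T : eqType) (r : seq I) (U : seq T)
    (f : I -> T) (F : I -> V) :
  uniq U -> {in r, forall i, f i \in U} ->
  \sum_(i <- r) F i = \sum_(u <- U) \sum_(i <- r | f i == u) F i.
Proof.
move=> uU fU; under [RHS]eq_bigr => u _ do rewrite big_mkcond.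
rewrite exchange_big/= big_seq [RHS]big_seq; apply: eq_bigr => i /fU fi.
rewrite (bigD1_seq (f i))//= eqxx big1 ?addr0// => u.
by rewrite eq_sym => /negbTE ->.
Qed.

Lemma visitsS (V : countType) (x : nat -> V) (t : nat) (v : V) :
  visits x t.+1 v = (visits x t v + (x t == v))%N.
Proof.
by rewrite /visits /index_iota !subn0 -addn1 iotaD count_cat/= addn0.
Qed.

(** The j-th exit from [u] uses entry j of the stack at [u], so the exits before time [t] use
    exactly the entries 1, ..., n_t(u). *)
Lemma sum_exits (R : nmodType) (V : countType) (sigma : V -> nat -> V)
    (x : nat -> V) (F : V -> V -> R) (u : V) (t : nat) :
  stack_walk sigma x ->
  \sum_(0 <= s < t | x s == u) F (x s) (x s.+1) =
  \sum_(1 <= j < (visits x t u).+1) F u (sigma u j).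
Proof.
move=> hx; elim: t => [|t IH]; first by rewrite !big_geq.
rewrite big_mkcond big_nat_recr//= -big_mkcond/= IH visitsS.
case: eqP => [xu|_]; last by rewrite addr0 addn0.
by rewrite addn1 [RHS]big_nat_recr//= hx xu.
Qed.

(** * Successor lists and the drift of h along the stack walk *)

Section Successors.
Variables (R : realType) (V : countType) (p : V -> V -> R).

Definition succs (u : V) : seq V :=
  finmap.enum_fset (fset_set [set v | 0 < p u v]).

Hypotheses (hp : markov_kernel p)
  (hfin : forall u, finite_set [set v | 0 < p u v]).

Lemma succs_uniq u : uniq (succs u).
Proof. exact: finmap.fset_uniq. Qed.

Lemma mem_succs u v : (v \in succs u) = (0 < p u v).
Proof.
have /= -> := in_fset_set (hfin u) v.
by apply/idP/idP => [/set_mem//|h]; apply/mem_set.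
Qed.

Lemma sum_succs u : \sum_(v <- succs u) p u v = 1.
Proof.
have [p0 /(_ u) p1] := hp; apply: EFin_inj; rewrite -p1 -sumEFin.
rewrite -(fsbig_finite _ (fun v => (p u v)%:E) (hfin u)).
rewrite -esum_fset//; last first.
  by move=> v _; rewrite lee_fin.
rewrite esum_mkcond; apply: eq_esum => v _; case: ifPn => //.
rewrite notin_setE/= => /negP; rewrite -leNgt => pv.
by congr EFin; apply/eqP; rewrite eq_le pv p0.
Qed.

(** A second successor would push the total mass above 1. This forces every exit from b or c to lead
    to a. *)
Lemma succs_det u v w : p u v = 1 -> 0 < p u w -> w = v.
Proof.
move=> puv puw; apply/eqP/negPn/negP => wv.
have := sum_succs u; have [p0 _] := hp.
rewrite (bigD1_seq v) ?succs_uniq ?mem_succs ?puv//= => /eqP.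
rewrite -[X in _ == X]addr0 (inj_eq (addrI _)) psumr_eq0// => /allP/(_ w).
by rewrite mem_succs// wv/= (gt_eqF puw) => /(_ puw).
Qed.
End Successors.

(* Harmonicity allows p(u,v) n to be subtracted from the number of exits from
   u to v, which leaves a coefficient of modulus at most 1. *)
Lemma exits_bound (R : realType) (V : countType) (p : V -> V -> R)
    (sigma : V -> nat -> V) (h : V -> R) (u : V) (n : nat) :
  markov_kernel p -> (forall v, finite_set [set w | 0 < p v w]) ->
  low_discrepancy_stack p sigma ->
  h u = \sum_(v <- succs p u) p u v * h v ->
  `|\sum_(1 <= j < n.+1) (h (sigma u j) - h u)|
    <= \sum_(v <- succs p u) `|h u - h v|.
Proof.
move=> hp hfin [spos sdisc] hu.
(* The discrepancy bound is available only from t = 1 on, so the empty sum is treated apart. *)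
case: n => [|n]; first by rewrite big_geq// normr0 sumr_ge0.
rewrite (@sum_count _ _ _ _ (succs p u) (sigma u) (fun v => h v - h u))
  ?succs_uniq//; last first.
  by move=> j; rewrite mem_index_iota mem_succs// => /andP[j1 _]; exact: spos.
have h0 : \sum_(v <- succs p u) p u v * n.+1%:R * (h v - h u) = 0.
  rewrite (eq_bigr (fun v => n.+1%:R * (p u v * h v - p u v * h u))) => [|v _];
    last by ring.
  by rewrite -mulr_sumr sumrB -hu -mulr_suml sum_succs// mul1r subrr mulr0.
rewrite -[X in `|X|]subr0 -[X in _ - X]h0 -sumrB.
apply: le_trans (ler_norm_sum _ _ _) _.
rewrite big_seq [leRHS]big_seq; apply: ler_sum => v; rewrite mem_succs// => puv.
rewrite -mulrBl normrM distrC (distrC (h u)) ler_piMl//.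
exact: sdisc.
Qed.

Lemma stack_walk_drift (R : realType) (V : countType) (p : V -> V -> R)
    (sigma : V -> nat -> V) (h : V -> R) (x : nat -> V) (a b c : V) (t : nat) :
  markov_kernel p -> (forall v, finite_set [set w | 0 < p v w]) ->
  low_discrepancy_stack p sigma -> stack_walk sigma x ->
  b <> c -> p b a = 1 -> p c a = 1 ->
  (forall u, u <> b -> u <> c -> h u = \sum_(v <- succs p u) p u v * h v) ->
  `|h (x t) - h (x 0%N) - ((visits x t b)%:R * (h a - h b) +
      (visits x t c)%:R * (h a - h c))|
    <= \sum_(u <- undup [seq x s | s <- iota 0 t] | (u != b) && (u != c))
         \sum_(v <- succs p u) `|h u - h v|.
Proof.
move=> hp hfin hs hx hbc hba hca harm.
rewrite -big_filter; set U := [seq u <- _ | _].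
have exits_det u : p u a = 1 ->
    \sum_(0 <= s < t | x s == u) (h (x s.+1) - h (x s)) =
    (visits x t u)%:R * (h a - h u).
  move=> pua; rewrite (sum_exits (fun u v => h v - h u) u t hx) big_add1/=.
  under eq_big_nat => j _.
    rewrite (@succs_det _ _ p hp hfin u a (sigma u j.+1) pua);
      last by apply: hs.1.
    over.
  by rewrite sumr_const_nat subn0 mulr_natl.
have -> : h (x t) - h (x 0%N) = \sum_(0 <= s < t) (h (x s.+1) - h (x s)).
  by rewrite telescope_sumr.
(* Steps are grouped by the vertex they leave. Listing b and c separately from [U] keeps the list
   duplicate-free and covers them even if they are unvisited. *)
rewrite (@sum_by_value _ _ _ _ (b :: c :: U) x); first last.
- move=> s; rewrite mem_index_iota/= => st.
  rewrite !inE mem_filter mem_undup map_f ?mem_iota// andbT.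
  by case: eqP => //= _; case: eqP.
- rewrite /= !inE !mem_filter !eqxx andbF/= (introF eqP hbc).
  by rewrite filter_uniq// undup_uniq.
rewrite !big_cons !exits_det// addrA [X in `|X|]addrAC subrr add0r.
apply: le_trans (ler_norm_sum _ _ _) _.
rewrite [leLHS]big_seq [leRHS]big_seq; apply: ler_sum => u.
rewrite mem_filter => /andP[/andP[/eqP ub /eqP uc] _].
rewrite (sum_exits (fun u v => h v - h u) u t hx).
by apply: exits_bound => //; exact: harm.
Qed.

(** The pairs (u, v) that occur are distinct, so the double sum is a finite partial sum of the one
    in [K6]. *)
Lemma K6_ge (R : realType) (V : countType) (p : V -> V -> R) (h : V -> R)
    (b c : V) (U : seq V) :
  (forall v, finite_set [set w | 0 < p v w]) -> (K6 p h b c < +oo)%E ->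
  uniq U -> {in U, forall u, u <> b /\ u <> c} ->
  1 + \sum_(u <- U) \sum_(v <- succs p u) `|h u - h v| <= fine (K6 p h b c).
Proof.
move=> hfin hK uU hU.
have K1 : ((1 + \sum_(u <- U) \sum_(v <- succs p u) `|h u - h v|)%:E
    <= K6 p h b c)%E.
  rewrite EFinD leeD2l//; apply: esum_ge.
  pose r := [seq (u, v) | u <- U, v <- succs p u].
  exists [set` r]; first split; first exact: finite_seq.
    move=> e /= /allpairsPdep[u [v [/hU[ub uc] vu ->]]].
    by move: vu; rewrite mem_succs.
  rewrite -fsbig_seq.
    by rewrite sumEFin big_allpairs_dep.
  apply: allpairs_uniq_dep => // [u _|]; first exact: succs_uniq.
  by move=> [u v] [u' v'] _ _ [-> ->].
(* Finiteness makes [fine] return the true value instead of the default 0. *)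
rewrite -lee_fin fineK// fin_numElt hK andbT.
exact: lt_le_trans (ltNyr _) K1.
Qed.

(** * The law of the first visit to {b, c} *)

Section HittingProbabilities.
Variables (R : realType) (V : countType) (p : V -> V -> R) (b c : V).

(* The probability, started from [v], of visiting {b, c} for the first time at
   time [n], and then at [b]. *)
Fixpoint hitp (n : nat) (v : V) : R :=
  if n is n'.+1 then
    if (v == b) || (v == c) then 0 else \sum_(y <- succs p v) p v y * hitp n' y
  else (v == b)%:R.

Hypotheses (hp : markov_kernel p)
  (hfin : forall u, finite_set [set v | 0 < p u v]).

Lemma hitp_ge0 n v : 0 <= hitp n v.
Proof.
have [p0 _] := hp; elim: n v => [|n IH] v /=; first by rewrite ler0n.
by case: ifP => // _; rewrite sumr_ge0// => y _; rewrite mulr_ge0.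
Qed.

(** The starting time [k] is a parameter so that the Markov recursion can move it to k + 1. *)
Definition hit_first_at (y : nat -> V) (k n : nat) : Prop :=
  y (k + n)%N = b /\ forall i, (k <= i < k + n)%N -> y i <> b /\ y i <> c.

(** T_b < T_c forces T_b to be finite, and the least time spent at b is the required n. *)
Lemma hitting_time_ltP (y : nat -> V) : b <> c ->
  (hitting_time R y b < hitting_time R y c)%E <->
  exists n, hit_first_at y 0 n.
Proof.
move=> bc; split.
  move=> /ereal_inf_lt[_ [s ysb <-]] sc.
  have ex : exists n, y n == b by exists s; apply/eqP.
  have [m /eqP ymb mmin] := ex_minnP ex.
  exists m; split; first by rewrite add0n.
  move=> i /=; rewrite add0n => im; split.
    by move=> /eqP /mmin; rewrite leqNgt im.
  move=> yic; move: sc; rewrite ltNge => /negP; apply.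
  apply: le_trans (_ : (i%:R%:E <= _)%E).
    by apply: ereal_inf_lbound; exists i.
  by rewrite lee_fin ler_nat (leq_trans (ltnW im))// mmin//; apply/eqP.
move=> [n []]; rewrite add0n => ynb yi.
apply: (@le_lt_trans _ _ n%:R%:E); first by apply: ereal_inf_lbound; exists n.
(* As b and c differ, c is not visited at time n either, so T_c is at least n + 1; this keeps the
   inequality strict also when T_c is infinite. *)
apply: (@lt_le_trans _ _ n.+1%:R%:E); first by rewrite lte_fin ltr_nat.
apply: le_ereal_inf_tmp => _ [s ysc <-].
rewrite lee_fin ler_nat ltnNge leq_eqVlt.
apply/negP => /orP[/eqP sn|sn]; first by apply: bc; rewrite -ynb -ysc sn.
by have [] := yi s sn.
Qed.

Variables (d : measure_display) (Omega : measurableType d)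
  (X : nat -> Omega -> V).
Hypothesis mX : forall t v, measurable (X t @^-1` [set v]).

Definition cylinder (x : nat -> V) (k : nat) : set Omega :=
  [set w | forall i, (i <= k)%N -> X i w = x i].

Definition hit_event (k n : nat) : set Omega :=
  [set w | hit_first_at (X ^~ w) k n].

Lemma measurable_cylinder x k : measurable (cylinder x k).
Proof.
rewrite (_ : cylinder x k =
    \bigcap_(i in [set i | (i <= k)%N]) (X i @^-1` [set x i])).
  by apply: bigcap_measurableType => i _; exact: mX.
by apply/seteqP; split.
Qed.

Lemma measurable_hit_event k n : measurable (hit_event k n).
Proof.
rewrite (_ : hit_event k n = (X (k + n)%N @^-1` [set b]) `&`
    \bigcap_(i in [set i | (k <= i < k + n)%N])
      (~` (X i @^-1` [set b]) `&` ~` (X i @^-1` [set c]))).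
  apply: measurableI; first exact: mX.
  apply: bigcap_measurableType => i _; apply: measurableI; exact: measurableC.
by apply/seteqP; split.
Qed.

Lemma hit_beforeE : b <> c ->
  [set w | (hitting_time R (X ^~ w) b < hitting_time R (X ^~ w) c)%E] =
  \bigcup_n hit_event 0 n.
Proof.
move=> bc; apply/seteqP; split=> w.
  by move=> /(hitting_time_ltP _ bc)[n]; exists n.
by move=> [n _ ?]; apply/(hitting_time_ltP _ bc); exists n.
Qed.

Variables (u : V) (P : probability Omega R).
Hypothesis hX : markov_chain p u P X.

(** Paths are total sequences, so [y] is appended by overwriting the whole tail; a cylinder up to
    time k + 1 sees only its first entry. *)
Definition extend (x : nat -> V) (k : nat) (y : V) (i : nat) : V :=
  if (i <= k)%N then x i else y.

Lemma cylinder_extend x k y :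
  cylinder (extend x k y) k.+1 = cylinder x k `&` (X k.+1 @^-1` [set y]).
Proof.
apply/seteqP; split=> w /=.
  move=> H; split=> [i ik|]; first by rewrite H ?(leqW ik)// /extend ik.
  by rewrite H// /extend ltnn.
move=> [H Hy] i; rewrite leq_eqVlt ltnS => /orP[/eqP ->|ik].
  by rewrite Hy /extend ltnn.
by rewrite H// /extend ik.
Qed.

Lemma prob_cylinder_extend x k y :
  P (cylinder (extend x k y) k.+1) = (P (cylinder x k) * (p (x k) y)%:E)%E.
Proof.
have [_ _ /(_ (extend x k y) k)] := hX.
rewrite {3 4}/extend leqnn ltnn => ->; congr (P _ * _)%E.
by apply/seteqP; split=> w /= H i ik; rewrite H// /extend ik.
Qed.

(** [C] minus [B] is null and contains [A] minus [B]. *)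
Lemma prob_sub_full (A B C : set Omega) :
  measurable A -> measurable B -> measurable C -> A `<=` C ->
  P (C `&` B) = P C -> P A = P (A `&` B).
Proof.
move=> mA mB mC AC PCB.
have CB0 : P (C `\` B) = 0%E.
  have fC := fin_num_measure P _ mC.
  by rewrite measureD//; [rewrite [X in (_ - X)%E]PCB subee|rewrite ltey_eq fC].
rewrite -{1}(setUIDK A B) measureU0//.
- exact: measurableI.
- exact: measurableD.
- apply: subset_measure0 CB0; try exact: measurableD.
  by apply: setSD.
Qed.

(* The successors already carry all the mass of the cylinder, so no countable
   sum over V is needed. *)
Lemma prob_step (A : set Omega) x k : measurable A -> A `<=` cylinder x k ->
  P A = (\sum_(y <- succs p (x k)) P (A `&` (X k.+1 @^-1` [set y])))%E.
Proof.
move=> mA AC.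
pose B := \bigcup_(y in [set` succs p (x k)]) (X k.+1 @^-1` [set y]).
have mB : measurable B.
  by rewrite /B bigcup_seq; apply: bigsetU_measurable => y _; exact: mX.
have split_sum D : measurable D ->
    P (D `&` B) =
    (\sum_(y <- succs p (x k)) P (D `&` (X k.+1 @^-1` [set y])))%E.
  move=> mD; rewrite /B setI_bigcupr bigcup_seq measure_fbigsetU//.
    by move=> y _; apply: measurableI.
  by move=> y z _ _ [w /= [[_ ->] [_ ->]]].
rewrite -split_sum//; apply: prob_sub_full AC _ => //.
  exact: measurable_cylinder.
(* By the Markov property the successors carry P(C) times the sum of p(x_k, y), which is P(C), for
   the cylinder C. *)
rewrite split_sum; last exact: measurable_cylinder.
under eq_bigr => y _ do rewrite -cylinder_extend prob_cylinder_extend.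
have fC := fin_num_measure P _ (measurable_cylinder x k).
rewrite -(fineK fC).
under eq_bigr => y _ do rewrite -EFinM.
by rewrite sumEFin -mulr_sumr sum_succs// mulr1.
Qed.

(** Induction on [n] with [k] and [x] free: splitting by the value of X_{k+1} lengthens the cylinder
    by one step and shortens the wait by one. *)
Lemma prob_cylinder_hit n k x :
  P (cylinder x k `&` hit_event k n) = (P (cylinder x k) * (hitp n (x k))%:E)%E.
Proof.
elim: n k x => [|n IH] k x /=.
  have hitE : hit_event k 0 = X k @^-1` [set b].
    apply/seteqP; split=> w; rewrite /hit_event /hit_first_at/= addn0.
      by case.
    by move=> ?; split=> // i /andP[/leq_ltn_trans/[apply]]; rewrite ltnn.
  rewrite hitE; case: eqP => [xb|xb].
    rewrite mule1; congr (P _); apply/setIidl => w /(_ k (leqnn k)) /=.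
    by rewrite xb.
  rewrite mule0 (_ : _ `&` _ = set0) ?measure0//.
  by apply/seteqP; split=> // w /= [/(_ k (leqnn k)) -> /xb].
case: ifPn => [xbc|xbc].
  (* A positive wait forbids b and c already at time k. *)
  rewrite mule0 (_ : _ `&` _ = set0) ?measure0//.
  apply/seteqP; split=> // w /= [/(_ k (leqnn k)) xk] [_ /(_ k)].
  rewrite leqnn addnS ltnS leq_addr xk => /(_ isT) [xb xc].
  by move: xbc => /orP[] /eqP.
rewrite (prob_step (x := x) (k := k)); last exact: subIsetl; last first.
  apply: measurableI; first exact: measurable_cylinder.
  exact: measurable_hit_event.
rewrite -sumEFin ge0_sume_distrr; last first.
  move=> y _; rewrite lee_fin mulr_ge0 ?hitp_ge0//; by have [] := hp.
apply: eq_bigr => y _; rewrite EFinM muleA -prob_cylinder_extend.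
have xy : extend x k y k.+1 = y by rewrite /extend ltnn.
have := IH k.+1 (extend x k y); rewrite xy => <-; congr (P _).
(* As x_k lies outside {b, c}, waiting n + 1 steps from k amounts to waiting n steps from k + 1. *)
rewrite cylinder_extend setIAC.
apply/seteqP; split=> w /= [[Hc Hy] [Hb H]]; (split; first by split).
- split; first by rewrite addSnnS.
  by move=> i /andP[ki ik]; apply: H; rewrite (ltnW ki) -addSnnS.
- split; first by rewrite -addSnnS.
  move=> i /andP[]; rewrite leq_eqVlt => /orP[/eqP <- _|ki ik].
    by rewrite Hc//; split; apply/eqP; move: xbc; rewrite negb_or => /andP[].
  by apply: H; rewrite ki addSnnS.
Qed.

(** The first-visit events are disjoint for different n, so countable additivity applies. *)
Lemma hit_before_probE : b <> c ->
  (hit_before_prob P X b c)%:E = (\sum_(0 <= n <oo) (hitp n u)%:E)%E.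
Proof.
move=> bc; have mE n := measurable_hit_event 0 n.
rewrite /hit_before_prob hit_beforeE//.
rewrite fineK; last by rewrite fin_num_measure//; exact: bigcup_measurable.
rewrite measure_bigcup//; last first.
  move=> i j _ _ [w []]; rewrite /hit_event /hit_first_at/= !add0n.
  move=> [ib Hi] [jb Hj]; apply/eqP; rewrite eqn_leq.
  apply/andP; split; rewrite leqNgt; apply/negP => ij.
    by have [] := Hi _ ij.
  by have [] := Hj _ ij.
rewrite (eq_eseriesl (Q := xpredT)); last by move=> n; rewrite in_setT.
apply: eq_eseriesr => n _; have [_ X0 _] := hX.
have cyl0 : cylinder (fun=> u) 0 = X 0%N @^-1` [set u].
  apply/seteqP; split=> w /=; first exact.
  by move=> Xu i; rewrite leqn0 => /eqP ->.
(* X_0 = u has probability 1, so intersecting with the cylinder of time 0 changes nothing. *)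
rewrite -[RHS]mul1e -X0 -cyl0 -(prob_cylinder_hit n 0 (fun=> u)) setIC.
apply: (@prob_sub_full _ _ setT) => //; first exact: measurable_cylinder.
by rewrite setTI cyl0 X0 probability_setT.
Qed.
End HittingProbabilities.

(** * Harmonicity, boundary values and range of h *)

Section HarmonicFunction.
Variables (R : realType) (V : countType) (p : V -> V -> R) (b c : V).
Hypotheses (hp : markov_kernel p)
  (hfin : forall u, finite_set [set v | 0 < p u v]) (bc : b <> c).
Variables (d : measure_display) (Omega : measurableType d)
  (P : V -> probability Omega R) (X : nat -> Omega -> V).
Hypothesis hX : forall u, markov_chain p u (P u) X.

Let h u := hit_before_prob (P u) X b c.

Let hE u : (h u)%:E = (\sum_(0 <= n <oo) (hitp p b c n u)%:E)%E.
Proof. by have [mX _ _] := hX u; exact: hit_before_probE. Qed.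

(** The term n = 0 is the indicator of b; the remaining terms obey the recursion of [hitp]. *)
Let hrec u :
  (h u)%:E = ((u == b)%:R%:E + \sum_(0 <= n <oo) (hitp p b c n.+1 u)%:E)%E.
Proof.
rewrite hE nneseries_recl//; last by move=> n _; rewrite lee_fin hitp_ge0.
rewrite -(@nneseries_addn _ _ 1) => [|n]; last by rewrite lee_fin hitp_ge0.
by under eq_eseriesr => n _ do rewrite addn1.
Qed.

Lemma hit_before_prob_harmonic u : u <> b -> u <> c ->
  h u = \sum_(v <- succs p u) p u v * h v.
Proof.
move=> /eqP/negbTE ub /eqP/negbTE uc; have [p0 _] := hp; apply: EFin_inj.
rewrite hrec ub add0e/= ub uc/=.
under eq_eseriesr => n _ do rewrite -sumEFin.
(* Nonnegativity of the terms justifies exchanging the series with the finite sum. *)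
rewrite nneseries_sum; last first.
  by move=> v n _; rewrite lee_fin mulr_ge0 ?hitp_ge0.
rewrite -sumEFin; apply: eq_bigr => v _; rewrite EFinM hE.
under eq_eseriesr => n _ do rewrite EFinM.
by rewrite nneseriesZl// => n _; rewrite lee_fin hitp_ge0.
Qed.

Lemma hit_before_prob_target : h b = 1.
Proof.
apply: EFin_inj; rewrite hrec eqxx eseries0 ?adde0// => n _ _ /=.
by rewrite eqxx.
Qed.

Lemma hit_before_prob_avoid : h c = 0.
Proof.
apply: EFin_inj; rewrite hrec (introF eqP (nesym bc)) add0e.
by rewrite eseries0// => n _ _ /=; rewrite eqxx orbT.
Qed.

(** This gives |h(x_t) - h(x_0)| <= 1, which the summand 1 in [K6] absorbs. *)
Lemma hit_before_prob_ge0_le1 u : 0 <= h u <= 1.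
Proof.
have [mX _ _] := hX u.
have mh : measurable
    [set w | (hitting_time R (X ^~ w) b < hitting_time R (X ^~ w) c)%E].
  rewrite hit_beforeE//; apply: bigcup_measurable => n _.
  exact: measurable_hit_event.
rewrite /h /hit_before_prob fine_ge0//= -lee_fin fineK ?fin_num_measure//.
exact: probability_le1.
Qed.
End HarmonicFunction.

(** * The discrepancy bound for the stack walk *)

Unset Implicit Arguments.
Set Strict Implicit.

Theorem theorem12 (R : realType) (V : countType) (p : V -> V -> R)
    (hp : markov_kernel p)
    (hfin : forall u : V, finite_set [set v : V | 0 < p u v])
    (d : measure_display) (Omega : measurableType d)
    (P : V -> probability Omega R) (X : nat -> Omega -> V)
    (hX : forall u : V, markov_chain p u (P u) X)
    (a b c : V) (hab : a <> b) (hac : a <> c) (hbc : b <> c)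
    (hba : p b a = 1) (hca : p c a = 1)
    (sigma : V -> nat -> V) (hsigma : low_discrepancy_stack p sigma)
    (h : V -> R) (hh : forall v : V, h v = hit_before_prob (P v) X b c)
    (hK : (K6 p h b c < +oo)%E)
    (x : nat -> V) (hx : stack_walk sigma x)
    (t : nat) (ht : (0 < visits x t b + visits x t c)%N) :
  `|h a - (visits x t b)%:R / (visits x t b + visits x t c)%:R|
    <= fine (K6 p h b c) / (visits x t b + visits x t c)%:R.
Proof.
move: hK ht; set N := visits x t b; set M := visits x t c => hK' N0.
set S := (N + M)%N in N0 *; set K := fine _.
have hb : h b = 1 by rewrite hh (hit_before_prob_target hp hfin hbc hX).
have hc : h c = 0 by rewrite hh (hit_before_prob_avoid hp hfin hbc hX).
have h01 v : 0 <= h v <= 1 by rewrite hh (hit_before_prob_ge0_le1 hbc hX).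
have harm u : u <> b -> u <> c -> h u = \sum_(v <- succs p u) p u v * h v.
  move=> ub uc; rewrite hh (hit_before_prob_harmonic hp hfin hbc hX)//.
  by apply: eq_bigr => v _; rewrite hh.
have S0 : 0 < S%:R :> R by rewrite ltr0n.
have := stack_walk_drift t hp hfin hsigma hx hbc hba hca harm.
(* With h(b) = 1 and h(c) = 0 the contribution of b and c is N (h(a) - 1) + M h(a) = S h(a) - N. *)
rewrite hb hc subr0 -/N -/M -big_filter; set U := [seq u <- _ | _] => drift.
have K1 : 1 + \sum_(u <- U) \sum_(v <- succs p u) `|h u - h v| <= K.
  apply: K6_ge => //; first by rewrite filter_uniq// undup_uniq.
  by move=> u; rewrite mem_filter => /andP[/andP[/eqP ? /eqP ?] _].
(* Clearing the denominator leaves |S h(a) - N| <= K. *)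
have -> : h a - N%:R / S%:R = (S%:R * h a - N%:R) / S%:R.
  by field; rewrite gt_eqF.
rewrite normrM normfV (gtr0_norm S0) ler_pM2r ?invr_gt0//.
have := h01 (x t); have := h01 (x 0%N).
move: drift; rewrite !ler_norml /S natrD => /andP[? ?] /andP[? ?] /andP[? ?].
by apply/andP; split; lra.
Qed.
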